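(* For every integer $N \ge 1$ there exist a group $\Gamma$ and a finite symmetric generating set $S \subset \Gamma \smallsetminus \{e\}$ such that the adjacency operator $A_G$ of the Cayley graph $G = \mathrm{Cay}(\Gamma, S)$ has pure band spectrum consisting of exactly $N$ disjoint intervals, i.e. $\Sigma(A_G) = \bigsqcup_{j=1}^N [a_j, b_j]$ with $a_j < b_j < a_{j+1}$ for $j = 1, \dots, N-1$ and $a_N < b_N$.
   Context: For a simple graph $G=(V,E)$ of bounded degree with countable vertex set, the adjacency operator $A_G$ is the bounded self-adjoint operator on $\ell^2(V)$ given by $(A_G\xi)(v) = \sum_{u : \{u,v\}\in E} \xi(u)$. $\Sigma(A)$ denotes the spectrum of an operator $A$. A bounded self-adjoint operator has pure band spectrum if its spectrum is a finite disjoint union of nondegenerate closed intervals $[a_j,b_j]$, $a_j<b_j$. The Cayley graph $\mathrm{Cay}(\Gamma,S)$ has vertex set $\Gamma$ and edges $\{g, gs\}$ for $g \in \Gamma$, $s \in S$. *)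

(* Defs.v *)
From HB Require Import structures.
From mathcomp Require Import all_boot all_order all_algebra.
From mathcomp Require Import all_classical all_reals all_analysis.
From mathcomp Require Export complex.

Set Implicit Arguments.
Unset Strict Implicit.
Unset Printing Implicit Defensive.

Import Order.TTheory GRing.Theory Num.Theory.

Local Open Scope classical_set_scope.
Local Open Scope ring_scope.

Record sgraph := SGraph {
  vertex :> choiceType;
  edge : vertex -> vertex -> Prop;
  edge_sym : forall u v, edge u v -> edge v u;
  edge_irr : forall v, ~ edge v v }.

Section Cayley.
Variables (G : groupType) (S : set G).

Definition generates : Prop :=
  forall H : {pred G}, group_closed H -> (forall s, S s -> s \in H) ->
    forall g, g \in H.

Definition symmetric_set : Prop := forall s, S s -> S s^-1%g.

(* {u, v} = {g, gs} for some g in G and s in S *)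
Definition cayley_edge (u v : G) : Prop :=
  exists2 s, S s & v = (u * s)%g \/ u = (v * s)%g.

Hypothesis S1 : ~ S 1%g.

Lemma cayley_edge_sym u v : cayley_edge u v -> cayley_edge v u.
Proof. by case=> s Ss [->|->]; exists s => //; [right|left]. Qed.

Lemma cayley_edge_irr v : ~ cayley_edge v v.
Proof.
case=> s Ss vE; apply: S1; suff <- : s = 1%g by [].
by apply: (mulgI v); rewrite mulg1; case: vE.
Qed.

Definition cayley : sgraph := SGraph cayley_edge_sym cayley_edge_irr.

End Cayley.

Section L2.
Variables (R : realType) (V : choiceType).
Implicit Types (xi eta : V -> R[i]) (T U : (V -> R[i]) -> (V -> R[i])).

Definition sqnorm2 xi : \bar R :=
  \esum_(v in [set: V]) (ComplexField.Normc.normc (xi v) ^+ 2)%:E.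

Definition l2 : set (V -> R[i]) := [set xi | (sqnorm2 xi < +oo)%E].

Definition norm2 xi : R := Num.sqrt (fine (sqnorm2 xi)).

(* Operators on l2 are represented by maps on all of V -> R[i]; only their
   restriction to l2 is meaningful. *)
Definition bounded_operator T : Prop :=
  [/\ forall xi, l2 xi -> l2 (T xi),
      forall (c : R[i]) xi eta, l2 xi -> l2 eta ->
        T (fun v => c * xi v + eta v) = (fun v => c * T xi v + T eta v) &
      exists M : R, forall xi, l2 xi -> norm2 (T xi) <= M * norm2 xi].

Definition shift T (z : R[i]) : (V -> R[i]) -> (V -> R[i]) :=
  fun xi v => T xi v - z * xi v.

Definition spectrum T : set R[i] :=
  [set z | ~ exists2 U, bounded_operator U &
     forall xi, l2 xi -> U (shift T z xi) = xi /\ shift T z (U xi) = xi].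

End L2.

(* The sum is over the neighbours of v with xi u != 0; it has the junk value 0
   when there are infinitely many of them, which cannot happen when v has finite
   degree. *)
Definition adjacency (R : realType) (G : sgraph) (xi : G -> R[i]) : G -> R[i] :=
  fun v => \sum_(u \in [set u | edge u v]) xi u.

(* Main.v *)
(* Adding a factor Z/5 with all its nonzero elements as generators is the
   Cartesian product with the complete graph K_5, whose adjacency matrix J - 1
   has eigenvalues -1 and 4.  Splitting l2 over this factor into the mean and
   the deviation from the mean shows that the spectrum X becomes
   (X - 1) u (X + 4).  Starting from Z, with spectrum [-2, 2], the N-th step
   has spectrum the N translates of [-2, 2] by c, c + 5, ..., c + 5 (N - 1),
   which are disjoint because 5 > 4.

   For Z, write T for the translation.  If w = s + 1/s with |s| < 1, then
   T + T^-1 - w = -(1/s) (1 - s T) (1 - s T^-1), and both factors are inverted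
   by Neumann series; if |s| = 1, then truncated plane waves s^k are
   approximate eigenvectors. *)
Require Import Defs.
From HB Require Import structures.
From mathcomp Require Import all_boot all_order all_algebra.
From mathcomp Require Import all_classical all_reals all_analysis.
From mathcomp Require Import zify ring lra finmap.

Set Implicit Arguments.
Unset Strict Implicit.
Unset Printing Implicit Defensive.

Import Order.TTheory GRing.Theory Num.Theory.
Import numFieldNormedType.Exports.
Import ComplexField.Normc.

Local Open Scope classical_set_scope.
Local Open Scope ring_scope.
Local Open Scope complex_scope.

(** * Square-summable families and bounded operators *)

Section ComplexModulus.
Variable R : realType.
Implicit Types z w : R[i].

Lemma sqr_normcE z : normc z ^+ 2 = complex.Re z ^+ 2 + complex.Im z ^+ 2.
Proof. by case: z => x y /=; rewrite sqr_sqrtr// addr_ge0 ?sqr_ge0. Qed.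

Lemma normc_ge0 z : 0 <= normc z.
Proof. by case: z => x y /=; rewrite sqrtr_ge0. Qed.

Lemma normcX z n : normc (z ^+ n) = normc z ^+ n.
Proof. by elim: n => [|n IH]; rewrite ?expr0 ?normc1// !exprS normcM IH. Qed.

Lemma sqr_normcD z w : normc (z + w) ^+ 2 <= 2 * normc z ^+ 2 + 2 * normc w ^+ 2.
Proof.
rewrite !sqr_normcE; case: z => a b; case: w => c d /=.
have := sqr_ge0 (a - c); have := sqr_ge0 (b - d); nra.
Qed.

(* Convexity of the square: the weights 1 - |s| and |s| are put on
   z / (1 - |s|) and on w. *)
Lemma sqr_normc_convex z s w : normc s < 1 ->
  normc (z + s * w) ^+ 2 <=
    (1 - normc s)^-1 * normc z ^+ 2 + normc s * normc w ^+ 2.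
Proof.
move=> s1; have r0 := normc_ge0 s.
have key (x y r : R) : 0 <= r -> r < 1 ->
    (x + r * y) ^+ 2 <= (1 - r)^-1 * x ^+ 2 + r * y ^+ 2.
  move=> hr0 hr1; have t0 : 0 < 1 - r by rewrite subr_gt0.
  rewrite -(ler_pM2l t0) [leRHS]mulrDr mulVKf ?(gt_eqF t0)// -subr_ge0.
  rewrite [leRHS](_ : _ = r * (x - (1 - r) * y) ^+ 2); last by ring.
  by rewrite mulr_ge0// sqr_ge0.
apply: le_trans (key _ _ _ r0 s1); rewrite ler_sqr ?nnegrE ?normc_ge0//.
  by rewrite -normcM; exact: le_normcD.
by rewrite addr_ge0 ?mulr_ge0 ?normc_ge0.
Qed.

End ComplexModulus.

Section SquareNorm.
Variables (R : realType) (V : choiceType).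
Implicit Types (xi eta zeta : V -> R[i]).

Lemma sqnorm2_ge0 xi : (0 <= sqnorm2 xi)%E.
Proof. by apply: esum_ge0 => v _; rewrite lee_fin sqr_ge0. Qed.

Lemma l2_fin_num xi : l2 xi -> sqnorm2 xi \is a fin_num.
Proof. by move=> h; rewrite ge0_fin_numE// sqnorm2_ge0. Qed.

Lemma esumZ_le (c : R) (a : V -> R) : 0 <= c -> (forall v, 0 <= a v) ->
  (\esum_(v in [set: V]) (c * a v)%:E <= c%:E * \esum_(v in [set: V]) (a v)%:E)%E.
Proof.
move=> c0 a0; rewrite /esum; apply: ge_ereal_sup => _ [X [finX XT]] <-.
rewrite fsbig_finite//=; under eq_bigr do rewrite EFinM.
rewrite -ge0_sume_distrr; last by move=> i _; rewrite lee_fin.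
apply: lee_wpmul2l; first by rewrite lee_fin.
by apply: ereal_sup_ubound; exists X => //; rewrite fsbig_finite.
Qed.

Lemma le_sqnorm2 (c : R) zeta xi : 0 <= c ->
  (forall v, normc (zeta v) ^+ 2 <= c * normc (xi v) ^+ 2) ->
  (sqnorm2 zeta <= c%:E * sqnorm2 xi)%E.
Proof.
move=> c0 h; apply: le_trans (esumZ_le c0 (fun v => sqr_ge0 _)).
by apply: le_esum => v _; rewrite lee_fin.
Qed.

Lemma le_sqnorm2D (c d : R) zeta xi eta : 0 <= c -> 0 <= d ->
  (forall v, normc (zeta v) ^+ 2
      <= c * normc (xi v) ^+ 2 + d * normc (eta v) ^+ 2) ->
  (sqnorm2 zeta <= c%:E * sqnorm2 xi + d%:E * sqnorm2 eta)%E.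
Proof.
move=> c0 d0 h; apply: le_trans; last first.
  by apply: leeD; [apply: esumZ_le => // v|apply: esumZ_le => // v]; exact: sqr_ge0.
rewrite -esumD; try by move=> v _; rewrite lee_fin mulr_ge0// sqr_ge0.
by apply: le_esum => v _; rewrite -EFinD lee_fin.
Qed.

Lemma sqnorm2D xi eta :
  (sqnorm2 (fun v => (xi v + eta v)%R) <= 2%:E * sqnorm2 xi + 2%:E * sqnorm2 eta)%E.
Proof. by apply: le_sqnorm2D => // v; exact: sqr_normcD. Qed.

Lemma sqnorm2Z (c : R[i]) xi :
  (sqnorm2 (fun v => (c * xi v)%R) <= (normc c ^+ 2)%:E * sqnorm2 xi)%E.
Proof. by apply: le_sqnorm2; rewrite ?sqr_ge0// => v; rewrite normcM exprMn. Qed.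

Lemma l2D xi eta : l2 xi -> l2 eta -> l2 (fun v => xi v + eta v).
Proof.
move=> hx hy; apply: le_lt_trans (sqnorm2D _ _) _.
by rewrite lte_add_pinfty// lte_mul_pinfty// lee_fin.
Qed.

Lemma l2Z (c : R[i]) xi : l2 xi -> l2 (fun v => c * xi v).
Proof.
move=> h; apply: le_lt_trans (sqnorm2Z _ _) _.
by rewrite lte_mul_pinfty// lee_fin sqr_ge0.
Qed.

Lemma sqnorm2_0 : sqnorm2 (fun _ : V => 0 : R[i]) = 0%E.
Proof. by apply: esum1 => v _; rewrite normc0 expr0n. Qed.

Lemma l2_0 : l2 (fun _ : V => 0 : R[i]).
Proof. by rewrite /l2/= sqnorm2_0. Qed.

Lemma sqnorm2_ge_sum (s : seq V) xi : uniq s ->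
  ((\sum_(v <- s) normc (xi v) ^+ 2)%:E <= sqnorm2 xi)%E.
Proof.
move=> us; apply: esum_ge; exists [set` s]; first by split.
by rewrite -fsbig_seq//= sumEFin.
Qed.

Lemma sqnorm2_ge1 (v : V) xi : ((normc (xi v) ^+ 2)%:E <= sqnorm2 xi)%E.
Proof. by have := @sqnorm2_ge_sum [:: v] xi isT; rewrite big_seq1. Qed.

Lemma l2_bounded xi : l2 xi ->
  exists K : R, forall v, normc (xi v) <= K.
Proof.
move=> hx; exists (norm2 xi) => v.
have q0 : 0 <= fine (sqnorm2 xi) by rewrite fine_ge0// sqnorm2_ge0.
rewrite -ler_sqr ?nnegrE ?normc_ge0 ?sqrtr_ge0// sqr_sqrtr//.
by rewrite -lee_fin fineK ?l2_fin_num// sqnorm2_ge1.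
Qed.

(** Reduces a norm bound to finite partial sums, where reindexing and pointwise limits are
    elementary. *)
Lemma sqnorm2_le_fin (M : \bar R) xi :
  (forall s : seq V, uniq s -> ((\sum_(v <- s) normc (xi v) ^+ 2)%:E <= M)%E) ->
  (sqnorm2 xi <= M)%E.
Proof.
move=> h; apply: ge_ereal_sup => _ [X [finX XT]] <-.
by rewrite fsbig_finite//= sumEFin; apply: h; exact: fset_uniq.
Qed.

End SquareNorm.

(** * Bounded operators between [l2] spaces and invertibility *)

Section BoundedOperators.
Variable R : realType.

(* The analogue of bounded_operator between different index types; bounds are on
   squared norms. *)
Definition bop (V W : choiceType) (T : (V -> R[i]) -> (W -> R[i])) : Prop :=
  (forall c xi eta, l2 xi -> l2 eta ->
     T (fun v => c * xi v + eta v) = (fun w => c * T xi w + T eta w)) /\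
  (exists2 M : R, 0 <= M &
     forall xi, l2 xi -> (sqnorm2 (T xi) <= M%:E * sqnorm2 xi)%E).

Lemma bop_l2 (V W : choiceType) (T : (V -> R[i]) -> (W -> R[i])) xi :
  bop T -> l2 xi -> l2 (T xi).
Proof.
move=> [_ [M M0 h]] hx; apply: le_lt_trans (h _ hx) _.
by rewrite lte_mul_pinfty// lee_fin.
Qed.

Lemma bop0 (V W : choiceType) (T : (V -> R[i]) -> (W -> R[i])) :
  bop T -> T (fun=> 0) = (fun=> 0).
Proof.
move=> [lT _]; have := lT (-1) _ _ (@l2_0 R V) (@l2_0 R V).
under [X in T X]eq_fun do rewrite mulr0 addr0.
by move=> ->; apply/funext => w; ring.
Qed.

Lemma bopD (V W : choiceType) (T : (V -> R[i]) -> (W -> R[i])) xi eta :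
  bop T -> l2 xi -> l2 eta ->
  T (fun v => xi v + eta v) = (fun w => T xi w + T eta w).
Proof.
move=> [lT _] hx hy; have := lT 1 _ _ hx hy.
under [X in T X]eq_fun do rewrite mul1r.
by move=> ->; apply/funext => w; rewrite mul1r.
Qed.

Lemma bopZ (V W : choiceType) (T : (V -> R[i]) -> (W -> R[i])) c xi :
  bop T -> l2 xi -> T (fun v => c * xi v) = (fun w => c * T xi w).
Proof.
move=> bT hx; have := bT.1 c _ _ hx (@l2_0 R V).
under [X in T X]eq_fun do rewrite addr0.
by move=> ->; apply/funext => w; rewrite bop0// addr0.
Qed.

Lemma bop_sum (V W : choiceType) (T : (V -> R[i]) -> (W -> R[i])) (I : Type)
    (s : seq I) (f : I -> V -> R[i]) : bop T -> (forall i, l2 (f i)) ->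
  l2 (fun v => \sum_(i <- s) f i v) /\
  T (fun v => \sum_(i <- s) f i v) = (fun w => \sum_(i <- s) T (f i) w).
Proof.
move=> bT hf; elim: s => [|i s [IH1 IH2]].
  under eq_fun do rewrite big_nil; split; first exact: l2_0.
  by rewrite bop0//; apply/funext => w; rewrite big_nil.
under eq_fun do rewrite big_cons; split; first exact: l2D.
by rewrite bopD// IH2; apply/funext => w; rewrite big_cons.
Qed.

Lemma bop_comp (U V W : choiceType) (S : (V -> R[i]) -> (W -> R[i]))
    (T : (U -> R[i]) -> (V -> R[i])) : bop S -> bop T -> bop (fun xi => S (T xi)).
Proof.
move=> bS bT; split.
  by move=> c xi eta hx hy; rewrite bT.1// bS.1//; exact: bop_l2.
case: bS (bT) => [_ [M M0 hM]] [_ [K K0 hK]].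
exists (M * K); rewrite ?mulr_ge0// => xi hx.
apply: le_trans (hM _ (bop_l2 bT hx)) _.
by rewrite EFinM -muleA lee_wpmul2l ?hK ?lee_fin.
Qed.

Lemma bop_add (V W : choiceType) (S T : (V -> R[i]) -> (W -> R[i])) :
  bop S -> bop T -> bop (fun xi w => S xi w + T xi w).
Proof.
move=> [lS [M M0 hM]] [lT [K K0 hK]]; split.
  by move=> c xi eta hx hy; apply/funext => w; rewrite lS// lT//; ring.
exists (2 * M + 2 * K); first lra.
move=> xi hx; apply: le_trans (sqnorm2D _ _) _.
rewrite [(2 * M + _)%:E]EFinD [leRHS]ge0_muleDl ?lee_fin ?mulr_ge0//.
by rewrite !EFinM -!muleA leeD// lee_wpmul2l// ?lee_fin// ?hM ?hK.
Qed.

Lemma bop_scale (V W : choiceType) c (T : (V -> R[i]) -> (W -> R[i])) :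
  bop T -> bop (fun xi w => c * T xi w).
Proof.
move=> [lT [K K0 hK]]; split.
  by move=> d xi eta hx hy; apply/funext => w; rewrite lT//; ring.
exists (normc c ^+ 2 * K); first by rewrite mulr_ge0// sqr_ge0.
move=> xi hx; apply: le_trans (sqnorm2Z _ _) _.
by rewrite [(_ * K)%:E]EFinM -muleA lee_wpmul2l ?lee_fin ?sqr_ge0// hK.
Qed.

Lemma bop_zero (V W : choiceType) : bop (fun (_ : V -> R[i]) (_ : W) => 0 : R[i]).
Proof.
split; first by move=> c xi eta _ _; apply/funext => w; rewrite mulr0 addr0.
by exists 0 => // xi _; rewrite sqnorm2_0 mul0e.
Qed.

Lemma bop_bigsum (V W : choiceType) (I : Type) (s : seq I)
    (T : I -> (V -> R[i]) -> (W -> R[i])) :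
  (forall i, bop (T i)) -> bop (fun xi w => \sum_(i <- s) T i xi w).
Proof.
move=> bT; elim: s => [|i s IH].
  rewrite (_ : (fun _ => _) = fun _ _ => 0); first exact: bop_zero.
  by apply/funext => xi; apply/funext => w; rewrite big_nil.
have := bop_add (bT i) IH; congr bop.
by apply/funext => xi; apply/funext => w; rewrite big_cons.
Qed.

Lemma sqnorm2_comap (V W : choiceType) (f : W -> V) (xi : V -> R[i]) :
  injective f -> (sqnorm2 (fun w => xi (f w)) <= sqnorm2 xi)%E.
Proof.
move=> fi; apply: sqnorm2_le_fin => s us.
apply: le_trans (@sqnorm2_ge_sum _ _ (map f s) xi _); rewrite ?map_inj_uniq//.
by rewrite big_map.
Qed.

Lemma bop_comap (V W : choiceType) (f : W -> V) : injective f ->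
  bop (fun (xi : V -> R[i]) (w : W) => xi (f w)).
Proof.
by move=> fi; split=> //; exists 1 => // xi _; rewrite mul1e sqnorm2_comap.
Qed.

(** Extension by zero along a partial injection. Each [v] is hit at most once, so a finite sum over
    [W] reindexes to a sum over distinct points of [V]. *)
Lemma bop_ext (V W : choiceType) (f : W -> option V) :
  (forall w w', f w = f w' -> f w -> w = w') ->
  bop (fun (xi : V -> R[i]) (w : W) => oapp xi 0 (f w)).
Proof.
move=> fi; split.
  by move=> c xi eta _ _; apply/funext => w; case: (f w) => //=; rewrite mulr0 addr0.
exists 1 => // xi _; rewrite mul1e; apply: sqnorm2_le_fin => s us.
have -> : \sum_(w <- s) normc (oapp xi 0 (f w)) ^+ 2
        = \sum_(v <- pmap f s) normc (xi v) ^+ 2.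
  rewrite big_pmap/=; apply: eq_bigr => w _.
  by case: (f w) => [v|]//; rewrite -[LHS]/(normc (0 : R[i]) ^+ 2) normc0 expr0n.
apply: sqnorm2_ge_sum; elim: s us => //= w s IH /andP[ws /IH us].
case E : (f w) => [v|] //=; rewrite us andbT mem_pmap.
apply: contra ws => /mapP[w' sw' Ew'].
by rewrite (fi w w') ?E.
Qed.

Lemma bounded_operatorP (V : choiceType) (T : (V -> R[i]) -> (V -> R[i])) :
  bounded_operator T <-> bop T.
Proof.
split=> [[Tl2 lT [M hM]]|bT].
  split=> //; exists (M ^+ 2); rewrite ?sqr_ge0// => xi hx.
  have fx := l2_fin_num hx; have fT := l2_fin_num (Tl2 _ hx).
  have x0 : 0 <= fine (sqnorm2 xi) by rewrite fine_ge0// sqnorm2_ge0.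
  have T0 : 0 <= fine (sqnorm2 (T xi)) by rewrite fine_ge0// sqnorm2_ge0.
  rewrite -(fineK fx) -(fineK fT) -EFinM lee_fin.
  have h := hM _ hx; have n0 : 0 <= norm2 (T xi) by rewrite sqrtr_ge0.
  have : norm2 (T xi) ^+ 2 <= (M * norm2 xi) ^+ 2.
    (* [M] has no given sign; the right-hand side is nonnegative because it dominates a norm. *)
    by rewrite ler_sqr ?nnegrE ?(le_trans n0 h).
  by rewrite exprMn !sqr_sqrtr.
split; [by move=> xi; exact: bop_l2|exact: bT.1|].
have [_ [M M0 hM]] := bT; exists (Num.sqrt M) => xi hx.
have fx := l2_fin_num hx; have fT := l2_fin_num (bop_l2 bT hx).
rewrite -sqrtrM// ler_wsqrtr// -lee_fin EFinM !fineK//.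
exact: hM.
Qed.

Definition invertible (V : choiceType) (T : (V -> R[i]) -> (V -> R[i])) : Prop :=
  exists2 U, bop U & forall xi, l2 xi -> U (T xi) = xi /\ T (U xi) = xi.

Lemma invertible_comp (V : choiceType) (S T : (V -> R[i]) -> V -> R[i]) : bop S -> bop T ->
  invertible S -> invertible T -> invertible (fun xi => S (T xi)).
Proof.
move=> bS bT [S' bS' hS] [T' bT' hT].
exists (fun xi => T' (S' xi)); first exact: bop_comp.
move=> xi hx; split.
  by rewrite (hS _ (bop_l2 bT hx)).1 (hT _ hx).1.
by rewrite (hT _ (bop_l2 bS' hx)).2 (hS _ hx).2.
Qed.

Lemma invertible_scale (V : choiceType) c (T : (V -> R[i]) -> V -> R[i]) : c != 0 -> bop T ->
  invertible T -> invertible (fun xi v => c * T xi v).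
Proof.
move=> c0 bT [T' bT' hT]; exists (fun xi v => c^-1 * T' xi v).
  exact: bop_scale.
move=> xi hx; split; apply/funext => v.
  by rewrite bopZ ?(hT _ hx).1 ?mulKf//; exact: bop_l2.
by rewrite bopZ ?(hT _ hx).2 ?mulVKf//; exact: bop_l2.
Qed.

Lemma spectrumP (V : choiceType) (T : (V -> R[i]) -> (V -> R[i])) z :
  spectrum T z <-> ~ invertible (Defs.shift T z).
Proof.
by split=> h [U bU hU]; apply: h; exists U => //; exact/bounded_operatorP.
Qed.

End BoundedOperators.

(** * Product with a complete graph *)

Section CompleteGraphProduct.
Variables (R : realType) (V : choiceType) (F : finType).
Variable A : (V -> R[i]) -> (V -> R[i]).
(** Linearity is asked on all functions, so that the algebraic identities below carry no summability
    conditions; adjacency operators of finite degree have it. *)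
Hypothesis linA : forall c xi eta,
  A (fun v => c * xi v + eta v) = (fun v => c * A xi v + A eta v).

Lemma op0 : A (fun=> 0) = (fun=> 0).
Proof.
have := linA (-1) (fun=> 0) (fun=> 0).
under [X in A X]eq_fun do rewrite mulr0 addr0.
by move=> ->; apply/funext => w; ring.
Qed.

Lemma opZ c xi : A (fun v => c * xi v) = (fun v => c * A xi v).
Proof.
have := linA c xi (fun=> 0).
under [X in A X]eq_fun do rewrite addr0.
by move=> ->; apply/funext => w; rewrite op0 addr0.
Qed.

Lemma opD xi eta : A (fun v => xi v + eta v) = (fun v => A xi v + A eta v).
Proof.
have := linA 1 xi eta.
under [X in A X]eq_fun do rewrite mul1r.
by move=> ->; apply/funext => w; rewrite mul1r.
Qed.

Lemma op_sum (I : Type) (s : seq I) (f : I -> V -> R[i]) :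
  A (fun v => \sum_(i <- s) f i v) = (fun v => \sum_(i <- s) A (f i) v).
Proof.
elim: s => [|i s IH].
  under eq_fun do rewrite big_nil; rewrite op0.
  by apply/funext => w; rewrite big_nil.
under eq_fun do rewrite big_cons; rewrite opD IH.
by apply/funext => w; rewrite big_cons.
Qed.

Definition slice (x : F) (xi : V * F -> R[i]) : V -> R[i] := fun v => xi (v, x).

Definition tens (phi : F -> R[i]) (eta : V -> R[i]) : V * F -> R[i] :=
  fun p => phi p.2 * eta p.1.

Lemma bop_slice x : bop (slice x).
Proof. by apply: (@bop_comap R _ _ (fun v => (v, x))) => v v' []. Qed.

Lemma bop_tens phi : bop (tens phi).
Proof.
(* [d x] identifies the fibre over [x] with [V], so [tens phi] is a finite combination of extensions
   by zero. *)
pose d (x : F) (p : V * F) := if p.2 == x then Some p.1 else None.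
have bd x : bop (fun (eta : V -> R[i]) p => oapp eta 0 (d x p)).
  apply: bop_ext => -[v y] [v' y']; rewrite /d/=.
  by case: eqVneq => [->|//]; case: eqVneq => [->|//] [->].
have := bop_bigsum (index_enum F) (fun x => bop_scale (phi x) (bd x)); congr bop.
apply/funext => eta; apply/funext => -[v y]; rewrite (bigD1 y)//=.
rewrite /d/= eqxx/= big1 ?addr0// => x /negbTE xy.
by rewrite eq_sym xy mulr0.
Qed.

(* The adjacency operator of the Cartesian product with the complete graph on
   F: the sum over all of F counts xi (v, x) itself, which is taken off. *)
Definition prodK (xi : V * F -> R[i]) : V * F -> R[i] :=
  fun p => A (slice p.2 xi) p.1 + (\sum_(y : F) xi (p.1, y) - xi p).

(** Here [phi] is an eigenvector of J - 1 for [mu]. The embedding [tens phi] and its left inverse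
    [P] both intertwine [prodK - z] with [A - (z - mu)], so compressing an inverse of the former
    between them inverts the latter. *)
Lemma prodK_invertible_eigen (phi : F -> R[i]) (mu k z : R[i]) :
  (forall x, \sum_y phi y - phi x = mu * phi x) ->
  \sum_x phi x ^+ 2 = k -> k != 0 ->
  invertible (Defs.shift prodK z) -> invertible (Defs.shift A (z - mu)).
Proof.
move=> hmu hk k0 [U bU hU].
(* The pairing with [phi] is bilinear, without conjugation, which is why [k] is a sum of squares and
   must be nonzero. *)
pose P (xi : V * F -> R[i]) : V -> R[i] :=
  fun v => k^-1 * \sum_x phi x * slice x xi v.
have bP : bop P.
  exact: bop_scale (bop_bigsum _ (fun x => bop_scale (phi x) (bop_slice x))).
have PE eta : P (tens phi eta) = eta.
  apply/funext => v; rewrite /P /slice /tens/=.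
  under eq_bigr do rewrite mulrA -expr2.
  by rewrite -mulr_suml hk mulKf.
have KE eta : Defs.shift prodK z (tens phi eta) = tens phi (Defs.shift A (z - mu) eta).
  apply/funext => -[v x]; rewrite /Defs.shift /prodK /slice /tens/= opZ -mulr_suml.
  transitivity (phi x * A eta v + (\sum_y phi y - phi x) * eta v - z * (phi x * eta v)).
    by ring.
  by rewrite hmu; ring.
have KP xi : P (Defs.shift prodK z xi) = Defs.shift A (z - mu) (P xi).
  apply/funext => v; rewrite /P /Defs.shift /prodK opZ.
  have -> : A (fun v => \sum_x phi x * slice x xi v) v
            = \sum_x phi x * A (slice x xi) v.
    rewrite (op_sum (index_enum F) (fun x v => phi x * slice x xi v)).
    by apply: eq_bigr => x _; rewrite opZ.
  (* J - 1 is symmetric, so it can be moved across the pairing onto [phi]. *)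
  have E : \sum_x phi x * (\sum_y slice y xi v - slice x xi v)
         = mu * \sum_x phi x * slice x xi v.
    under eq_bigr do rewrite mulrBr mulr_sumr.
    rewrite sumrB exchange_big/= -sumrB mulr_sumr; apply: eq_bigr => x _.
    by rewrite -mulr_suml -mulrBl hmu mulrA.
  rewrite [(z - mu) * _]mulrCA -mulrBr; congr (_ * _).
  rewrite mulrBl -E mulr_sumr opprB addrA -big_split/= -sumrB.
  by apply: eq_bigr => x _; rewrite /slice/=; ring.
exists (fun eta => P (U (tens phi eta))).
  exact: bop_comp bP (bop_comp bU (bop_tens phi)).
move=> eta heta; have h := bop_l2 (bop_tens phi) heta.
by rewrite -KE -KP !(hU _ h).1 !(hU _ h).2 !PE.
Qed.

(** J - 1 acts as #|F| - 1 on the fibrewise mean and as -1 on the deviation from it; the inverse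
    applies [U1] to the mean and [U0] to the deviation. *)
Lemma prodK_invertible (z : R[i]) : (0 < #|F|)%N ->
  invertible (Defs.shift A (z + 1)) -> invertible (Defs.shift A (z + 1 - #|F|%:R)) ->
  invertible (Defs.shift prodK z).
Proof.
move=> F0 [U0 b0 h0] [U1 b1 h1].
have n0 : #|F|%:R != 0 :> R[i] by rewrite pnatr_eq0 -lt0n.
pose avg (xi : V * F -> R[i]) : V -> R[i] :=
  fun v => #|F|%:R^-1 * \sum_x slice x xi v.
pose dev x (xi : V * F -> R[i]) : V -> R[i] :=
  fun v => slice x xi v + (-1) * avg xi v.
have bavg : bop avg.
  exact: bop_scale (bop_bigsum _ bop_slice).
have bdev x : bop (dev x) by exact: bop_add (bop_slice x) (bop_scale _ bavg).
have sumdev xi v : \sum_x dev x xi v = 0.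
  by rewrite big_split/= sumr_const /avg -mulr_natl; field.
pose W x xi : V -> R[i] := fun v => U1 (avg xi) v + U0 (dev x xi) v.
have bW x : bop (W x) by exact: bop_add (bop_comp b1 bavg) (bop_comp b0 (bdev x)).
pose U (xi : V * F -> R[i]) : V * F -> R[i] := fun p => W p.2 xi p.1.
(* [U] is the finite sum over [x] of [W x] placed on the fibre over [x]. *)
have bU : bop U.
  have := bop_bigsum (index_enum F) (fun x =>
    bop_comp (bop_tens (fun y => (y == x)%:R)) (bW x)).
  congr bop; apply/funext => xi; apply/funext => -[v x].
  rewrite (bigD1 x)//= /tens/= eqxx mul1r big1 ?addr0// => y /negbTE yx.
  by rewrite eq_sym yx mul0r.
have Aavg xi v : A (avg xi) v = #|F|%:R^-1 * \sum_x A (slice x xi) v.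
  by rewrite opZ; congr (_ * _); rewrite (op_sum (index_enum F) (fun x => slice x xi)).
have avgK xi : avg (Defs.shift prodK z xi) = Defs.shift A (z + 1 - #|F|%:R) (avg xi).
  apply/funext => v; rewrite /Defs.shift Aavg.
  rewrite /avg /prodK /slice/= sumrB !big_split/= sumrN sumr_const.
  rewrite -mulr_sumr -mulr_natl; field.
  exact: n0.
have devK x xi : dev x (Defs.shift prodK z xi) = Defs.shift A (z + 1) (dev x xi).
  rewrite /dev avgK; apply/funext => v; rewrite /Defs.shift /prodK opD (opZ (-1)).
  have S : \sum_y xi (v, y) = #|F|%:R * avg xi v by rewrite /avg mulVKf.
  move: (A (avg xi) v) (avg xi v) S => a b S.
  rewrite [X in X + _]/slice/= S [slice x xi v]/slice; ring.
exists U => // xi hx; split.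
  apply/funext => -[v x]; rewrite /U /W/= avgK devK.
  rewrite (h1 _ (bop_l2 bavg hx)).1 (h0 _ (bop_l2 (bdev x) hx)).1.
  by rewrite /dev /slice; ring.
(* The deviations sum to zero over each fibre, hence so do their images under [U0]. *)
have sumU v : \sum_x U xi (v, x) = #|F|%:R * U1 (avg xi) v.
  rewrite /U /W/= big_split/= sumr_const mulr_natl.
  have [_ /(congr1 (fun f => f v))] := bop_sum (index_enum F) b0
    (fun x => bop_l2 (bdev x) hx).
  under [X in U0 X]eq_fun do rewrite sumdev.
  by rewrite bop0// => <-; rewrite addr0.
have e1 v := congr1 (fun f => f v) (h1 _ (bop_l2 bavg hx)).2.
have e0 x v := congr1 (fun f => f v) (h0 _ (bop_l2 (bdev x) hx)).2.
apply/funext => -[v x]; rewrite {1}/Defs.shift /prodK sumU.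
have -> : slice (v, x).2 (U xi) = W x xi by [].
rewrite /= /W opD /U/= /W.
have := e1 v; have := e0 x v; rewrite /Defs.shift/= /dev /slice => E0 E1.
have -> : xi (v, x) = xi (v, x) + -1 * avg xi v + avg xi v by ring.
by rewrite -E0 -E1; ring.
Qed.

(** Two points of [F] are what makes -1 an eigenvalue of J - 1. *)
Lemma prodK_invertibleP (z : R[i]) : (1 < #|F|)%N ->
  invertible (Defs.shift prodK z) <->
  invertible (Defs.shift A (z + 1)) /\ invertible (Defs.shift A (z + 1 - #|F|%:R)).
Proof.
move=> F1; split=> [h|[]]; last exact/prodK_invertible/ltnW.
have [x0 [x1 [_ _ x01]]] := card_gt1P F1.
split.
(* A vector of sum zero, killed by J, hence of eigenvalue -1; its squares sum to 2. *)
- pose phi x : R[i] := (x == x0)%:R - (x == x1)%:R.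
  have sumd (y : F) : \sum_x (x == y)%:R = 1 :> R[i].
    by rewrite (bigD1 y)//= eqxx big1 ?addr0// => x /negbTE ->.
  have -> : z + 1 = z - (-1) by rewrite opprK.
  apply: (@prodK_invertible_eigen phi (-1) 2) h => //.
  + by move=> x; rewrite /phi sumrB !sumd; ring.
  + transitivity (\sum_x (x == x0)%:R + \sum_x (x == x1)%:R : R[i]); last by rewrite !sumd.
    rewrite -big_split/=; apply: eq_bigr => x _; rewrite /phi.
    have [->|_] := eqVneq x x0; first by rewrite (negbTE x01)/=; ring.
    by case: eqVneq => _ /=; ring.
(* The constant vector has eigenvalue #|F| - 1. *)
- have -> : z + 1 - #|F|%:R = z - (#|F|%:R - 1) by ring.
  apply: (@prodK_invertible_eigen (fun=> 1) _ #|F|%:R) h.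
  + by move=> x; rewrite sumr_const; ring.
  + by under eq_bigr do rewrite expr1n; rewrite sumr_const.
  + by rewrite pnatr_eq0 -lt0n ltnW.
Qed.

End CompleteGraphProduct.

(** * The adjacency operator of the line *)

Section ComplexSequences.
Variable R : realType.
Implicit Types (u v : nat -> R[i]) (l m c : R[i]).

(* R[i] carries no normed structure over R here, so convergence is taken
   coordinatewise. *)
Definition ccvg u l : Prop :=
  (fun n => complex.Re (u n)) @ \oo --> complex.Re l /\
  (fun n => complex.Im (u n)) @ \oo --> complex.Im l.

Definition clim u : R[i] :=
  (lim ((fun n => complex.Re (u n)) @ \oo) +i*
   lim ((fun n => complex.Im (u n)) @ \oo))%C.

Lemma ccvg_clim u l : ccvg u l -> clim u = l.
Proof.
by case: l => a b [/= ha hb]; rewrite /clim (cvg_lim _ ha)// (cvg_lim _ hb).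
Qed.

Lemma ccvgD u v l m : ccvg u l -> ccvg v m -> ccvg (fun n => u n + v n) (l + m).
Proof.
have hRe (x y : R[i]) : complex.Re (x + y) = complex.Re x + complex.Re y.
  by case: x y => [? ?] [? ?].
have hIm (x y : R[i]) : complex.Im (x + y) = complex.Im x + complex.Im y.
  by case: x y => [? ?] [? ?].
move=> [ua ub] [vc vd]; split.
  by rewrite hRe; under eq_fun do rewrite hRe; exact: cvgD.
by rewrite hIm; under eq_fun do rewrite hIm; exact: cvgD.
Qed.

Lemma ccvgZ c u l : ccvg u l -> ccvg (fun n => c * u n) (c * l).
Proof.
have hRe (x y : R[i]) : complex.Re (x * y)
    = complex.Re x * complex.Re y - complex.Im x * complex.Im y.
  by case: x y => [? ?] [? ?].
have hIm (x y : R[i]) : complex.Im (x * y)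
    = complex.Re x * complex.Im y + complex.Im x * complex.Re y.
  by case: x y => [? ?] [? ?].
move=> [ua ub]; split.
  by rewrite hRe; under eq_fun do rewrite hRe; apply: cvgB; exact: cvgMr.
by rewrite hIm; under eq_fun do rewrite hIm; apply: cvgD; exact: cvgMr.
Qed.

Lemma ccvg_cst l : ccvg (fun=> l) l.
Proof. by split; exact: cvg_cst. Qed.

Lemma ccvgS u l : ccvg u l -> ccvg (fun n => u n.+1) l.
Proof.
move=> [ua ub]; split.
  by rewrite (cvg_shiftS (fun n => complex.Re (u n))).
by rewrite (cvg_shiftS (fun n => complex.Im (u n))).
Qed.

Lemma ccvg_sqr_normc u l : ccvg u l ->
  (fun n => normc (u n) ^+ 2) @ \oo --> normc l ^+ 2.
Proof.
move=> [ua ub]; rewrite sqr_normcE; under eq_fun do rewrite sqr_normcE.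
by apply: cvgD; rewrite !expr2; under eq_fun do rewrite expr2; exact: cvgM.
Qed.

Lemma normr_Re_le (z : R[i]) : `|complex.Re z| <= normc z.
Proof.
rewrite -ler_sqr ?nnegrE ?normr_ge0 ?normc_ge0// real_normK ?num_real//.
by rewrite sqr_normcE lerDl sqr_ge0.
Qed.

Lemma normr_Im_le (z : R[i]) : `|complex.Im z| <= normc z.
Proof.
rewrite -ler_sqr ?nnegrE ?normr_ge0 ?normc_ge0// real_normK ?num_real//.
by rewrite sqr_normcE lerDr sqr_ge0.
Qed.

Lemma cvg_geometric_bound (K r : R) (a : nat -> R) : 0 <= r < 1 ->
  (forall n, `|a n| <= K * r ^+ n) -> a @ \oo --> 0.
Proof.
move=> /andP[r0 r1] h; apply: norm_cvg0.
have g : geometric K r @ \oo --> 0 by apply: cvg_geometric; rewrite ger0_norm.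
apply: (@squeeze_cvgr _ _ _ _ (fun=> 0) (geometric K r)) => //; last exact: cvg_cst.
by near=> n; rewrite normr_ge0 h.
Unshelve. all: by end_near. Qed.

Lemma ccvg0_geometric (K r : R) u : 0 <= r < 1 ->
  (forall n, normc (u n) <= K * r ^+ n) -> ccvg u 0.
Proof.
move=> r01 h; split; apply: (@cvg_geometric_bound K r) => // n.
  exact: le_trans (normr_Re_le _) (h n).
exact: le_trans (normr_Im_le _) (h n).
Qed.

Lemma cvg_series_geometric (K r : R) (a : nat -> R) : 0 <= r < 1 ->
  (forall n, `|a n| <= K * r ^+ n) -> cvgn (series a).
Proof.
move=> /andP[r0 r1] h.
have g : cvgn (series (geometric K r)).
  by apply: is_cvg_geometric_series; rewrite ger0_norm.
have g0 n : 0 <= geometric K r n by exact: le_trans (normr_ge0 _) (h n).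
exact: (@normed_cvg R R^o a (series_le_cvg (fun=> normr_ge0 _) g0 h g)).
Qed.

Lemma ccvg_series_geometric (K r : R) u : 0 <= r < 1 ->
  (forall n, normc (u n) <= K * r ^+ n) ->
  ccvg (fun n => \sum_(k < n) u k) (clim (fun n => \sum_(k < n) u k)).
Proof.
move=> r01 h.
have hRe n : complex.Re (\sum_(k < n) u k)
           = series (fun k => complex.Re (u k)) n.
  by rewrite /series/= big_mkord; apply: (big_morph _ (id1 := 0)) => // -[? ?] [? ?].
have hIm n : complex.Im (\sum_(k < n) u k)
           = series (fun k => complex.Im (u k)) n.
  by rewrite /series/= big_mkord; apply: (big_morph _ (id1 := 0)) => // -[? ?] [? ?].
split => /=.
  have -> : (fun n => complex.Re (\sum_(k < n) u k))
           = series (fun k => complex.Re (u k)) by apply/funext.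
  apply: (cvg_series_geometric r01) => n.
  exact: le_trans (normr_Re_le _) (h n).
have -> : (fun n => complex.Im (\sum_(k < n) u k))
         = series (fun k => complex.Im (u k)) by apply/funext.
apply: (cvg_series_geometric r01) => n.
exact: le_trans (normr_Im_le _) (h n).
Qed.

End ComplexSequences.

(** * Neumann series of 1 - s T, where T is composition with [tau] *)

Section Neumann.
Variables (R : realType) (V : choiceType) (tau : V -> V) (s : R[i]).
Hypotheses (tau_inj : injective tau) (s1 : normc s < 1).
Implicit Types xi eta : V -> R[i].

Definition neumann_sum n xi v : R[i] := \sum_(k < n) s ^+ k * xi (iter k tau v).

Definition neumann xi v : R[i] := clim (fun n => neumann_sum n xi v).

(** Splitting off the first term gives the recursion behind the norm bound and the right inverse;
    splitting off the last one, as in [neumann_sumSr], gives the telescoping for the left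
    inverse. *)
Lemma neumann_sumS n xi v :
  neumann_sum n.+1 xi v = xi v + s * neumann_sum n xi (tau v).
Proof.
rewrite /neumann_sum big_ord_recl expr0 mul1r mulr_sumr; congr (_ + _).
by apply: eq_bigr => k _; rewrite exprS mulrA iterSr.
Qed.

Lemma neumann_sumSr n xi v :
  neumann_sum n.+1 xi v = neumann_sum n xi v + s ^+ n * xi (iter n tau v).
Proof. exact: big_ord_recr. Qed.

Lemma normc_itv : 0 <= normc s < 1.
Proof. by rewrite normc_ge0 s1. Qed.

Lemma neumann_term_le xi : l2 xi ->
  exists K : R, forall v n, normc (s ^+ n * xi (iter n tau v)) <= K * normc s ^+ n.
Proof.
move=> /l2_bounded[K hK]; exists K => v n.
by rewrite normcM normcX mulrC ler_wpM2r// exprn_ge0// normc_ge0.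
Qed.

Lemma neumann_cvg xi v : l2 xi -> ccvg (fun n => neumann_sum n xi v) (neumann xi v).
Proof.
move=> /neumann_term_le[K hK].
exact: (@ccvg_series_geometric R K (normc s) _ normc_itv (hK v)).
Qed.

Let C : R := (1 - normc s) ^- 2.

(** With r = |s|, [neumann_sumS] and convexity bound the squared norm at [n.+1] by 1/(1 - r) times
    that of [xi] plus r times the one at [n]. The constant [C] is the fixed point of this recursion:
    C = 1/(1 - r) + r C. Working with squares avoids the triangle inequality in [l2]. *)
Lemma sqnorm2_neumann_sum n xi : l2 xi ->
  (sqnorm2 (neumann_sum n xi) <= C%:E * sqnorm2 xi)%E.
Proof.
move=> hx; have t0 : 0 < 1 - normc s by rewrite subr_gt0.
have C0 : 0 <= C by rewrite invr_ge0 exprn_ge0// ltW.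
elim: n => [|n IH].
  rewrite (_ : neumann_sum 0 xi = fun=> 0).
    by rewrite sqnorm2_0 mule_ge0// sqnorm2_ge0.
  by apply/funext => v; rewrite /neumann_sum big_ord0.
pose eta v := neumann_sum n xi (tau v).
have heta : (sqnorm2 eta <= C%:E * sqnorm2 xi)%E.
  exact: le_trans (sqnorm2_comap _ tau_inj) IH.
have hS : (sqnorm2 (neumann_sum n.+1 xi)
    <= (1 - normc s)^-1%:E * sqnorm2 xi + (normc s)%:E * sqnorm2 eta)%E.
  apply: le_sqnorm2D => [||v]; [by rewrite invr_ge0 ltW|exact: normc_ge0|].
  by rewrite neumann_sumS; exact: sqr_normc_convex.
have hs : ((normc s)%:E * sqnorm2 eta <= (normc s)%:E * (C%:E * sqnorm2 xi))%E.
  by apply: lee_wpmul2l heta; rewrite lee_fin normc_ge0.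
apply: le_trans hS (le_trans (leeD (lexx _) hs) _).
rewrite muleA -EFinM -ge0_muleDl ?lee_fin ?invr_ge0 ?mulr_ge0 ?normc_ge0 ?(ltW t0)//.
rewrite lee_wpmul2r ?sqnorm2_ge0// -EFinD lee_fin le_eqVlt; apply/orP; left.
by apply/eqP; rewrite /C; field; rewrite gt_eqF.
Qed.

Lemma bop_neumann : bop neumann.
Proof.
have C0 : 0 <= C by rewrite invr_ge0 exprn_ge0// subr_ge0 ltW.
split.
  move=> c xi eta hx hy; apply/funext => v; rewrite {1}/neumann.
  have E n : neumann_sum n (fun v => c * xi v + eta v) v =
      c * neumann_sum n xi v + neumann_sum n eta v.
    by rewrite /neumann_sum mulr_sumr -big_split/=; apply: eq_bigr => k _; ring.
  under eq_fun do rewrite E.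
  by apply: ccvg_clim; apply: ccvgD; [apply: ccvgZ|]; exact: neumann_cvg.
exists C => // xi hx; apply: sqnorm2_le_fin => t ut.
have fx := l2_fin_num hx; rewrite -(fineK fx) -EFinM lee_fin.
(* As in Fatou's lemma: over a fixed finite [t] the pointwise limit preserves the bound, which is
   uniform in [n]. *)
have h : (fun n => \sum_(v <- t) normc (neumann_sum n xi v) ^+ 2) @ \oo
     --> \sum_(v <- t) normc (neumann xi v) ^+ 2.
  apply: cvg_big => [|v _]; first exact: add_continuous.
  exact/ccvg_sqr_normc/neumann_cvg.
rewrite -(cvg_lim _ h)//; apply: limr_le; first by apply/cvg_ex; eexists; exact: h.
apply: nearW => n; rewrite -lee_fin EFinM fineK//.
exact: le_trans (sqnorm2_ge_sum _ ut) (sqnorm2_neumann_sum n hx).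
Qed.

Lemma bop_sub_comap : bop (fun (xi : V -> R[i]) v => xi v - s * xi (tau v)).
Proof.
have := bop_add (@bop_comap R V V id (@inj_id V)) (bop_scale (- s) (bop_comap R tau_inj)).
by congr bop; apply/funext => xi; apply/funext => v; rewrite mulNr.
Qed.

Lemma invertible_sub_comap :
  invertible (fun (xi : V -> R[i]) v => xi v - s * xi (tau v)).
Proof.
exists neumann; first exact: bop_neumann.
move=> xi hx; split; apply/funext => v.
  (* The sum telescopes; the remainder tends to 0 because elements of [l2] are bounded. *)
  have E n : neumann_sum n (fun v => xi v - s * xi (tau v)) v
           = xi v + (-1) * (s ^+ n * xi (iter n tau v)).
    elim: n => [|n IH]; first by rewrite /neumann_sum big_ord0 /= expr0; ring.
    by rewrite neumann_sumSr IH exprS /=; ring.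
  rewrite /neumann; under eq_fun do rewrite E.
  apply: ccvg_clim; rewrite -[X in ccvg _ X]addr0; apply: ccvgD; first exact: ccvg_cst.
  rewrite -[X in ccvg _ X](mulr0 (-1)); apply: ccvgZ.
  have [K hK] := neumann_term_le hx.
  exact: ccvg0_geometric normc_itv (hK v).
have h := ccvgS (neumann_cvg v hx).
(* The limit of the recursion [neumann_sumS]. *)
have -> : neumann xi v = xi v + s * neumann xi (tau v).
  apply: ccvg_clim.
  have := ccvgD (ccvg_cst (xi v)) (ccvgZ s (neumann_cvg (tau v) hx)).
  under eq_fun do rewrite -neumann_sumS.
  move=> [h1 h2]; split.
    by move: h1; rewrite (cvg_shiftS (fun n => complex.Re (neumann_sum n xi v))).
  by move: h2; rewrite (cvg_shiftS (fun n => complex.Im (neumann_sum n xi v))).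
by rewrite addrK.
Qed.

End Neumann.

(** * Resolvent of a translation plus its inverse *)

Section Line.
Variables (R : realType) (V : choiceType) (tau taui : V -> V).
Hypotheses (tauK : cancel tau taui) (tauiK : cancel taui tau).

Definition line (xi : V -> R[i]) : V -> R[i] := fun v => xi (tau v) + xi (taui v).

Lemma line_invertible (s : R[i]) : normc s < 1 -> s != 0 ->
  invertible (Defs.shift line (s + s^-1)).
Proof.
move=> s1 s0.
have b1 := bop_sub_comap s (can_inj tauK); have b2 := bop_sub_comap s (can_inj tauiK).
have := invertible_comp b1 b2 (invertible_sub_comap (can_inj tauK) s1)
  (invertible_sub_comap (can_inj tauiK) s1).
move=> /(invertible_scale (c := - s^-1)) h.
have := h _ (bop_comp b1 b2); rewrite oppr_eq0 invr_eq0 => /(_ s0).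
congr invertible; apply/funext => xi; apply/funext => v.
by rewrite /Defs.shift /line tauK; field.
Qed.

End Line.

(* w = s + 1/s has a solution with |s| <= 1, and |s| = 1 forces w = 2 Re s. *)
Lemma joukowski (R : realType) (w : R[i]) :
  ~ (exists2 x : R, -2 <= x <= 2 & w = x%:C) ->
  exists s : R[i], [/\ normc s < 1, s != 0 & w = s + s^-1].
Proof.
(* A square root of the discriminant of X^2 - w X + 1, whose roots (w + d)/2 and (w - d)/2 have
   product 1 and sum [w]. *)
move=> hw; pose d : R[i] := sqrtC (w ^+ 2 - 4).
have hd : d ^+ 2 = w ^+ 2 - 4 by exact: sqrtCK.
have hst : (w + d) / 2 * ((w - d) / 2) = 1.
  rewrite (_ : _ * _ = (w ^+ 2 - d ^+ 2) / 4); last by field.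
  by rewrite hd; field.
have hs : (w + d) / 2 + (w - d) / 2 = w by field.
move: ((w + d) / 2) ((w - d) / 2) hst hs => s t hst hs.
have s0 : s != 0 by apply: contraPneq hst => ->; rewrite mul0r => /esym/eqP; rewrite oner_eq0.
have t0 : t != 0 by apply: contraPneq hst => ->; rewrite mulr0 => /esym/eqP; rewrite oner_eq0.
have sV : s^-1 = t by apply: (mulfI s0); rewrite divff// hst.
have hn : normc s * normc t = 1 by rewrite -normcM hst normc1.
have ns0 := normc_ge0 s; have nt0 := normc_ge0 t.
have [s1|s1|s1] := ltgtP (normc s) 1.
- by exists s; rewrite s1 s0 sV hs.
- exists t; split => //; last by rewrite -sV invrK sV addrC hs.
  rewrite ltNge; apply/negP => t1.
  have : 1 < normc s * normc t by rewrite (lt_le_trans s1)// ler_peMr.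
  by rewrite hn ltxx.
- case: hw; exists (2 * complex.Re s).
    have := sqr_normcE s; rewrite s1; move: (complex.Re s) (complex.Im s) => a b.
    have := sqr_ge0 b; move: (b ^+ 2) => B B0 hab; apply/andP; split; nra.
  rewrite -hs; have -> : t = s^*%C.
    apply: (mulfI s0); rewrite hst; have := sqr_normcE s; rewrite s1 expr1n.
    case: s {s1 hst hs s0 sV hn ns0} => a b /= hab.
    by apply/eqP; rewrite eq_complex /= hab; apply/andP; split; apply/eqP; ring.
  case: s {s1 hst hs s0 sV hn ns0} => a b /=.
  by apply/eqP; rewrite eq_complex/= addrN eqxx andbT; apply/eqP; ring.
Qed.

(** * Spectrum of the integer line *)

Section IntegerLine.
Variable R : realType.

Definition intline : (int -> R[i]) -> int -> R[i] := line (+%R 1) (+%R (- 1)).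

Definition delta (k : int) : int -> R[i] := fun v => (v == k)%:R.

Lemma sqnorm2_delta k : (sqnorm2 (delta k) <= 1)%E.
Proof.
apply: sqnorm2_le_fin => s us; rewrite lee_fin.
have [ks|ks] := boolP (k \in s).
  rewrite (bigD1_seq k)//= {1}/delta eqxx normc1 expr1n big1 ?addr0// => v /negbTE vk.
  by rewrite /delta vk normc0 expr0n.
rewrite big_seq big1 ?ler01// => v vs.
rewrite /delta (_ : v == k = false) ?normc0 ?expr0n//.
by apply/eqP => vk; rewrite -vk vs in ks.
Qed.

Lemma l2_delta k : l2 (delta k).
Proof. exact: le_lt_trans (sqnorm2_delta k) (ltry _). Qed.

(* The plane wave v |-> s^v cut off to [0, n[ is an approximate eigenvector. *)
Definition wave (s : R[i]) n : int -> R[i] :=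
  fun v => \sum_(k < n) s ^+ k * delta k v.

Lemma l2_wave s n : l2 (wave s n).
Proof.
elim: n => [|n IH].
  by rewrite /wave; under eq_fun do rewrite big_ord0; exact: l2_0.
by rewrite /wave; under eq_fun do rewrite big_ord_recr; exact/l2D/l2Z/l2_delta.
Qed.

(** The wave has modulus 1 at each of the [n] points of its window. *)
Lemma sqnorm2_wave_ge (s : R[i]) n : normc s = 1 -> (n%:R%:E <= sqnorm2 (wave s n))%E.
Proof.
move=> s1; have inj : injective (fun k : 'I_n => Posz k).
  by move=> j k [] /val_inj.
have := sqnorm2_ge_sum (wave s n) (s := map (fun k : 'I_n => Posz k) (index_enum 'I_n)).
rewrite map_inj_uniq// index_enum_uniq => /(_ isT); apply: le_trans.
rewrite lee_fin big_map (eq_bigr (fun=> 1)) ?sumr_const ?card_ord// => k _.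
rewrite /wave (bigD1 k)//= big1 => [|j jk].
  by rewrite /delta eqxx mulr1 addr0 normcX s1 !expr1n.
by rewrite /delta (inj_eq inj) eq_sym (negbTE jk) mulr0.
Qed.

(** An uncut wave would give zero; only the two ends of the window contribute. *)
Lemma wave_step s n v :
  wave s n (1 + v) - s * wave s n v = delta (-1) v - s ^+ n * delta (n%:Z - 1) v.
Proof.
have dS k : delta k (1 + v) = delta (k - 1) v.
  by rewrite /delta; congr (_%:R); congr nat_of_bool; lia.
elim: n => [|n IH]; first by rewrite /wave !big_ord0 expr0 add0r; ring.
rewrite /wave !big_ord_recr /= -!/(wave _ _ _).
transitivity (wave s n (1 + v) - s * wave s n v
  + s ^+ n * delta n (1 + v) - s ^+ n.+1 * delta n v); first by rewrite exprS; ring.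
rewrite IH dS (_ : n.+1%:Z - 1 = n); last by lia.
by ring.
Qed.

(** T + T^-1 - s - 1/s = (1 - (1/s) T^-1) (T - s), and T - s leaves two point masses of modulus 1 by
    [wave_step]. Each factor is bounded by the inequality for the square of a sum: 2 + 2 = 4, then 8
    + 8 = 16, independently of [n]. *)
Lemma sqnorm2_shift_wave (s : R[i]) n : normc s = 1 ->
  (sqnorm2 (Defs.shift intline (s + s^-1)%R (wave s n)) <= 16%:E)%E.
Proof.
move=> s1; have s0 : s != 0.
  by apply/eqP => s0; move: s1; rewrite s0 normc0 => /esym/eqP; rewrite oner_eq0.
pose d v := delta (-1) v - s ^+ n * delta (n%:Z - 1) v.
have d4 : (sqnorm2 d <= 4%:E)%E.
  apply: (@le_trans _ _ (2%:E * sqnorm2 (delta (-1))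
                        + 2%:E * sqnorm2 (delta (n%:Z - 1)))%E).
    apply: le_sqnorm2D => // v; apply: le_trans (sqr_normcD _ _) _.
    by rewrite normcN normcM normcX s1 expr1n mul1r.
  have h k : (2%:E * sqnorm2 (delta k) <= 2%:E)%E.
    rewrite -[leRHS]mule1; apply: lee_wpmul2l; first by rewrite lee_fin.
    exact: sqnorm2_delta.
  apply: le_trans (leeD (h _) (h _)) _.
  by rewrite -EFinD lee_fin; lra.
have E v : Defs.shift intline (s + s^-1) (wave s n) v
         = d v + (- s^-1) * d (-1 + v).
  have e : 1 + (-1 + v) = v by lia.
  by rewrite /d -!wave_step e /Defs.shift /intline /line; field.
have -> : Defs.shift intline (s + s^-1) (wave s n) = fun v => d v + (- s^-1) * d (-1 + v).
  exact/funext.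
apply: (@le_trans _ _ (2%:E * sqnorm2 d + 2%:E * sqnorm2 (fun v => d (-1 + v)%R))%E).
  apply: le_sqnorm2D => // v; apply: le_trans (sqr_normcD _ _) _.
  by rewrite normcM normcN normcV s1 invr1 mul1r.
have d4' : (sqnorm2 (fun v => d (-1 + v)%R) <= 4%:E)%E.
  exact: le_trans (sqnorm2_comap _ (addrI (-1))) d4.
have h (t : \bar R) : (t <= 4%:E)%E -> (2%:E * t <= 8%:E)%E.
  move=> t4; apply: (@le_trans _ _ (2%:E * 4%:E)%E).
    by apply: (lee_wpmul2l _ t4); rewrite lee_fin.
  by rewrite -EFinM lee_fin; lra.
by apply: le_trans (leeD (h _ d4) (h _ d4')) _; rewrite -EFinD lee_fin; lra.
Qed.

(** A bounded inverse would keep the squared norms of all waves below 16 M, yet they are at least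
    [n]. *)
Lemma intline_not_invertible (s : R[i]) : normc s = 1 ->
  ~ invertible (Defs.shift intline (s + s^-1)).
Proof.
move=> s1 [U bU hU].
have [_ [M M0 hM]] := bU.
have lw n : l2 (Defs.shift intline (s + s^-1) (wave s n)).
  exact: le_lt_trans (sqnorm2_shift_wave n s1) (ltry _).
have bound n : n%:R <= M * 16.
  rewrite -lee_fin EFinM; apply: le_trans (sqnorm2_wave_ge n s1) _.
  rewrite -(hU _ (l2_wave s n)).1; apply: le_trans (hM _ (lw n)) _.
  by apply: lee_wpmul2l; [rewrite lee_fin|exact: sqnorm2_shift_wave].
have := archi_boundP (mulr_ge0 M0 (ler0n R 16)).
by rewrite ltNge bound.
Qed.

Lemma intline_spectrum : spectrum intline = [set x%:C | x in [set` `[(-2 : R), 2]]].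
Proof.
apply/seteqP; split=> [w /spectrumP nw|_ [x /= xI <-]].
  apply: contrapT => hw; apply: nw.
  have [|s [s1 s0 ->]] := @joukowski R w.
    by move=> [x xI wx]; apply: hw; exists x => //=; rewrite in_itv.
  by apply: line_invertible => // v; lia.
apply/spectrumP; move: xI; rewrite in_itv /= => /andP[x1 x2].
(* Completes x/2 to a point [s] of the unit circle, where s + 1/s = 2 Re s = x. *)
pose y := Num.sqrt (1 - (x / 2) ^+ 2).
have hy : (x / 2) ^+ 2 + y ^+ 2 = 1 by rewrite sqr_sqrtr; [ring|nra].
pose s : R[i] := ((x / 2) +i* y)%C.
have s1 : normc s = 1 by rewrite /s /= hy sqrtr1.
have sV : s^-1 = s^*%C.
  have s0 : s != 0.
    by apply/eqP => s0; move: s1; rewrite s0 normc0 => /esym/eqP; rewrite oner_eq0.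
  apply: (mulfI s0); rewrite divff//; apply/eqP; rewrite eq_complex /=.
  by apply/andP; split; apply/eqP; rewrite -?[LHS]hy; ring.
have -> : x%:C = s + s^-1.
  by rewrite sV; apply/eqP; rewrite eq_complex /= addrN eqxx andbT; apply/eqP; field.
exact: intline_not_invertible.
Qed.

End IntegerLine.

(** * Cayley graphs *)

(* The additive group of a Z-module, written multiplicatively. *)
Definition addgroup (V : zmodType) : Type := V.

HB.instance Definition _ (V : zmodType) := Choice.on (addgroup V).
HB.instance Definition _ (V : zmodType) :=
  isGroup.Build (addgroup V) (@addrA V) (@add0r V) (@addr0 V) (@addNr V) (@addrN V).

Section CayleyAdjacency.
Variables (R : realType) (V : zmodType) (S : set (addgroup V)).
Hypotheses (S1 : ~ S 1%g) (finS : finite_set S) (symS : symmetric_set S).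

Definition cayley_op : (addgroup V -> R[i]) -> addgroup V -> R[i] :=
  @adjacency R (cayley S1).

(** By symmetry of [S] both clauses of the edge relation describe the set v + S, and translation by
    [v] is injective. *)
Lemma cayley_opE (xi : V -> R[i]) (v : V) :
  cayley_op xi v = \sum_(s \in S) xi (v + s).
Proof.
rewrite /cayley_op /adjacency (_ : [set u | _] = (fun s : V => v + s) @` S).
  by rewrite fsbig_image// => s t _ _ /addrI.
have e (u : V) : cayley_edge S u v <-> exists2 s : V, S s & v + s = u.
  split=> [[s Ss [->|->]]|[s Ss <-]]; last by exists s; [|right].
    by exists (- s); [exact: (symS Ss)|exact: addrK].
  by exists s.
apply/seteqP; split => u h; [exact: (e u).1 h|exact: (e u).2 h].
Qed.

(** Finiteness of [S] rules out the junk value of the sum, so linearity holds beyond [l2], as [linA]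
    requires. *)
Lemma cayley_op_linear c (xi eta : V -> R[i]) :
  cayley_op (fun v => c * xi v + eta v) =
  (fun v => c * cayley_op xi v + cayley_op eta v).
Proof.
apply/funext => v; rewrite !cayley_opE !fsbig_finite// mulr_sumr -big_split/=.
by [].
Qed.

End CayleyAdjacency.

Section IntegerGroup.
Variable R : realType.

Definition int_gens : set (addgroup int) := [set (1 : int)] `|` [set (-1 : int)].

Lemma int_gens1 : ~ int_gens 1%g.
Proof. by case. Qed.

Lemma int_gens_fin : finite_set int_gens.
Proof. by rewrite finite_setU; split; exact: finite_set1. Qed.

Lemma int_gens_sym : symmetric_set int_gens.
Proof. by move=> s [->|->]; [right|left]. Qed.

Lemma int_gens_generates : generates int_gens.
Proof.
move=> H Hc Hs g.
have H1 : (1 : int) \in H by apply: Hs; left.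
have HV : {in H, forall x, (- x : int) \in H} := group_closedV Hc.
have HM : {in H &, forall x y, (x + y : int) \in H} := group_closedM Hc.
have Hn (n : nat) : (n%:Z : int) \in H.
  elim: n => [|n IH]; first exact: Hc.1.
  by rewrite intS; apply: HM.
by case: g => n; rewrite ?NegzE; [|apply: HV]; exact: Hn.
Qed.

Lemma int_cayley_op : @cayley_op R _ _ int_gens1 = intline (R := R).
Proof.
apply/funext => xi; apply/funext => v.
rewrite (cayley_opE _ int_gens_sym) fsbigU0; try exact: finite_set1.
  by rewrite !fsbig_set1 /intline /line ![v + _]addrC.
by move=> x [/= ->].
Qed.

End IntegerGroup.

(** * Cayley graph of the product with the cyclic group of order n + 1 *)

Section CayleyProduct.
Variables (R : realType) (V : zmodType) (n : nat) (S : set (addgroup V)).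
Hypotheses (S1 : ~ S 1%g) (finS : finite_set S) (symS : symmetric_set S)
  (genS : generates S).

Definition prod_gens : set (addgroup (V * 'I_n.+1)%type) :=
  ((fun s : V => (s, 0)) @` S) `|`
  ((fun y : 'I_n.+1 => (0, y)) @` [set y | y != 0]).

Lemma prod_gens1 : ~ prod_gens 1%g.
Proof.
case=> [[s Ss [s0]]|[y /= y0 [yE]]]; first by apply: S1; rewrite -[1%g]s0.
by move/eqP: y0; apply.
Qed.

Lemma prod_gens_fin : finite_set prod_gens.
Proof.
rewrite finite_setU; split; first exact: finite_image finS.
exact: finite_image finite_finset.
Qed.

Lemma prod_gens_sym : symmetric_set prod_gens.
Proof.
move=> _ [[s Ss <-]|[y /= y0 <-]]; [left|right].
  by exists (- s); [exact: symS|congr pair; rewrite oppr0].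
by exists (- y); [rewrite /= oppr_eq0|congr pair; rewrite oppr0].
Qed.

Lemma prod_gens_generates : generates prod_gens.
Proof.
move=> H Hc Hs [v x].
have HM : {in H &, forall x y, (x + y : V * 'I_n.+1) \in H} := group_closedM Hc.
have H0 y : (0, y) \in H.
  have [->|y0] := eqVneq y 0; first exact: Hc.1.
  by apply: Hs; right; exists y.
have HV : (v, 0) \in H.
  (* The preimage of [H] under v |-> (v, 0) is a subgroup of [V] containing [S]. *)
  apply: (genS (H := [pred v : addgroup V | (v, 0) \in H])) => [|s Ss].
    split=> [|a b]; first exact: Hc.1.
    rewrite !inE => Ha Hb; have := Hc.2 _ _ Ha Hb.
    by congr (_ \in H); congr pair; exact: subrr.
  by rewrite inE; apply: Hs; left; exists s.
by have := HM _ _ HV (H0 x); congr (_ \in H); congr pair; rewrite ?addr0 ?add0r.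
Qed.

Lemma prod_cayley_op :
  @cayley_op R _ _ prod_gens1 =
  @prodK R V 'I_n.+1 (@cayley_op R _ _ S1).
Proof.
apply/funext => xi; apply/funext => -[v x].
rewrite (cayley_opE _ prod_gens_sym) fsbigU0.
- rewrite !fsbig_image; [|by move=> ? ? _ _ []|by move=> ? ? _ _ []].
  rewrite /prodK cayley_opE//; congr (_ + _).
    by apply: eq_fsbigr => s _; rewrite /slice /=; congr xi; congr pair; exact: addr0.
  have bigE (f : 'I_n.+1 -> R[i]) :
      \sum_(y \in [set y | y != 0]) f y = \sum_(y | y != 0) f y.
    by rewrite [RHS]bigfs ?index_enum_uniq// => i; rewrite mem_index_enum.
  rewrite bigE.
  (* Recentring the fibre sum at [x] makes the subtracted term [xi (v, x)] the one of index 0. *)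
  rewrite [in RHS](reindex_inj (addrI x))/= [in RHS](bigD1 0)//= addr0 [RHS]addrC addKr.
  by apply: eq_bigr => y _; congr xi; congr pair; exact: addr0.
- exact: finite_image finS.
- exact: finite_image finite_finset.
- by move=> _ [[s Ss <-] [y /= y0 [_ y0']]]; move/eqP: y0; apply.
Qed.

End CayleyProduct.

(** * Counting the bands *)

Section Bands.
Variable R : realType.

Definition bands (c : R) (N : nat) : set R[i] :=
  \bigcup_(j < N) [set x%:C | x in [set` `[c + 5 * j%:R - 2, c + 5 * j%:R + 2]]].

Lemma bandsP c N w : bands c N w <->
  exists (j : nat) (x : R), [/\ (j < N)%N, w = x%:C &
    c + 5 * j%:R - 2 <= x <= c + 5 * j%:R + 2].
Proof.
split=> [[j /= jN [x xI <-]]|[j [x [jN -> xI]]]].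
  by exists j, x; rewrite in_itv in xI.
by exists j => //; exists x => //=; rewrite in_itv.
Qed.

(** The translates by -1 and by 4 have centres c - 1 + 5 j with j < N and with 1 <= j <= N
    respectively: they agree except at the two extremes. For N = 0 both would be empty. *)
Lemma bandsS c N w : (0 < N)%N ->
  bands (c - 1) N.+1 w <-> bands c N (w + 1) \/ bands c N (w + 1 - 5).
Proof.
move=> N0; rewrite !bandsP; split.
  move=> [j [x [jN -> /andP[x1 x2]]]].
  have [jN'|jN'] := ltnP j N.
    left; exists j, (x + 1); split => //; first by rewrite rmorphD.
    by apply/andP; split; lra.
  (* Here [j] is [N], the last band, which comes from index N - 1 in the translate by 4. *)
  case: j jN jN' x1 x2 => [|j] jN jN' x1 x2; first lia.
  right; exists j, (x + 1 - 5); split; first lia.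
    by rewrite rmorphB rmorphD rmorph_nat.
  by move: x1 x2; rewrite -natr1 => x1 x2; apply/andP; split; lra.
case=> -[j [x [jN wE /andP[x1 x2]]]].
  exists j, (x - 1); split; [lia| |by apply/andP; split; lra].
  by rewrite -[w](addrK 1) wE rmorphB.
exists j.+1, (x + 4); split; first by lia.
  by rewrite -[w](addrK 1) -[w + 1](subrK 5) wE rmorphD rmorph_nat; ring.
by rewrite -natr1; apply/andP; split; lra.
Qed.

(** The group built is the product of the integers with [N] copies of Z/5. The offset [c] is
    existential because it drops by 1 at each step. *)
Lemma cayley_bands (N : nat) : exists (V : zmodType) (S : set (addgroup V))
    (S1 : ~ S 1%g),
  [/\ finite_set S, symmetric_set S, generates S &
    exists c : R, @spectrum R V (@cayley_op R V S S1) = bands c N.+1].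
Proof.
elim: N => [|N [V [S [S1 [finS symS genS [c hc]]]]]].
  exists int, int_gens, int_gens1; split.
  - exact: int_gens_fin.
  - exact: int_gens_sym.
  - exact: int_gens_generates.
  - exists 0; rewrite int_cayley_op intline_spectrum.
    rewrite /bands bigcup_mkord big_ord_recr big_ord0 /= set0U.
    by rewrite mulr0 !add0r.
exists (V * 'I_5)%type, (@prod_gens V 4 S), (@prod_gens1 V 4 S S1); split.
- exact: prod_gens_fin.
- exact: prod_gens_sym.
- exact: prod_gens_generates.
exists (c - 1); rewrite (@prod_cayley_op R V 4 S S1)//.
have linA := cayley_op_linear S1 finS symS (R := R).
apply/seteqP; split=> w.
  move=> /spectrumP; rewrite (prodK_invertibleP linA) ?card_ord// => /not_andP[h|h];
    apply/bandsS => //; [left|right]; by rewrite -hc; apply/spectrumP.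
move=> /bandsS-/(_ isT) h; apply/spectrumP.
rewrite (prodK_invertibleP linA) ?card_ord// => -[h1 h2].
by case: h; rewrite -hc => /spectrumP.
Qed.

End Bands.

Theorem theorem1 (R : realType) (N : nat) (hN : (1 <= N)%N) :
  exists (Gamma : groupType) (S : set Gamma) (S1 : ~ S 1%g),
    [/\ finite_set S, symmetric_set S, generates S &
      exists a b : nat -> R,
        [/\ forall j, (j < N)%N -> a j < b j,
            forall j, (j.+1 < N)%N -> b j < a j.+1 &
            spectrum (@adjacency R (cayley S1)) =
              \bigcup_(j < N) [set x%:C | x in [set` `[a j, b j]]]]].
Proof.
case: N hN => // N _.
have [V [S [S1 [finS symS genS [c hc]]]]] := cayley_bands R N.
exists (addgroup V), S, S1; split => //.
exists (fun j => c + 5 * j%:R - 2), (fun j => c + 5 * j%:R + 2); split.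
- by move=> j _; lra.
(* Bands of length 4 with period 5 leave gaps of length 1. *)
- by move=> j _; rewrite -natr1; lra.
- exact: hc.
Qed.
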